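(* Let $s,t\in\mathbb{N}$ with $s\geq t\geq 2$. There is a constant $c_{s,t}$ depending only on $s$ and $t$ such that for every $n\in\mathbb{N}$ with $n\geq 2s+t-1$, \[ \mathrm{sat}^{*}\left(n,\mathcal{K}_{s,t}\right)\leq\left(\binom{s+t-1}{t}(s-1)+\binom{s+t-1}{t-1}(t-1)\right)n+c_{s,t}. \]
   Context: For $n\in\mathbb{N}$, $[n]=\{1,\dots,n\}$ and $2^{[n]}$ is the family of all subsets of $[n]$. For posets $\mathcal{P}$ and $\mathcal{Q}$, $\mathcal{Q}$ contains an induced copy of $\mathcal{P}$ if there is an injective map $f:\mathcal{P}\to\mathcal{Q}$ with $f(x)\preceq_{\mathcal{Q}}f(y)$ if and only if $x\preceq_{\mathcal{P}}y$. The complete bipartite poset $\mathcal{K}_{s,t}$ consists of $s$ pairwise incomparable elements (upper layer) and $t$ pairwise incomparable elements (lower layer), where every upper element is larger than every lower element, and there are no other relations. A family $\mathcal{F}\subseteq 2^{[n]}$ is induced $\mathcal{P}$-saturated if $(\mathcal{F},\subseteq)$ contains no induced copy of $\mathcal{P}$, but for every $F\in 2^{[n]}\setminus\mathcal{F}$ the poset $(\mathcal{F}\cup\{F\},\subseteq)$ contains an induced copy of $\mathcal{P}$. $\mathrm{sat}^{*}(n,\mathcal{P})$ denotes the minimum size of an induced $\mathcal{P}$-saturated family $\mathcal{F}\subseteq 2^{[n]}$. *)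

(* Defs.v *)
From HB Require Import structures.
From mathcomp Require Import all_boot all_order.

Set Implicit Arguments.
Unset Strict Implicit.
Unset Printing Implicit Defensive.

(* [inl] is the upper layer (s elements), [inr] the lower layer (t elements). *)
Definition complete_bipartite (s t : nat) : Type := ('I_s + 'I_t)%type.

HB.instance Definition _ s t := Finite.on (complete_bipartite s t).

Section CompleteBipartite.
Variables s t : nat.

Definition cb_le (x y : complete_bipartite s t) : bool :=
  match x, y with
  | inr _, inl _ => true
  | _, _ => x == y
  end.

Lemma cb_le_refl : reflexive cb_le.
Proof. by case=> i /=; rewrite eqxx. Qed.

Lemma cb_le_anti : antisymmetric cb_le.
Proof. by case=> i [] j //= /andP[/eqP]. Qed.

Lemma cb_le_trans : transitive cb_le.
Proof. by case=> j [] i [] k //= /eqP->. Qed.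

Fact cb_display : Order.disp_t. Proof. exact: Order.Disp tt tt. Qed.

HB.instance Definition _ :=
  Order.Le_isPOrder.Build cb_display (complete_bipartite s t)
    cb_le_refl cb_le_anti cb_le_trans.

End CompleteBipartite.

Section Saturation.
Variables (d : Order.disp_t) (P : finPOrderType d) (n : nat).

(* The family F is viewed as a poset ordered by inclusion. *)
Definition contains_induced_copy (F : {set {set 'I_n}}) : bool :=
  [exists f : {ffun P -> {set 'I_n}},
    [&& injectiveb f,
        [forall x, f x \in F] &
        [forall x, forall y, (f x \subset f y) == (x <= y)%O]]].

Definition induced_saturated (F : {set {set 'I_n}}) : bool :=
  ~~ contains_induced_copy F &&
  [forall A : {set 'I_n}, (A \notin F) ==> contains_induced_copy (A |: F)].

Lemma induced_saturated_exists :
  0 < #|P| -> exists F : {set {set 'I_n}}, induced_saturated F.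
Proof.
move=> P_gt0; have copy0 : ~~ contains_induced_copy set0.
  apply/existsP => -[f /and3P[_ /forallP f0 _]].
  by have [x _] := card_gt0P P_gt0; have := f0 x; rewrite inE.
have [F /maxsetP[ncF maxF] _] :=
  @maxset_exists _ (fun F => ~~ contains_induced_copy F) set0 copy0.
exists F; rewrite /induced_saturated ncF; apply/forallP => A.
apply/implyP => AnF; apply: contraT => ncAF.
by move: AnF; rewrite -(maxF _ ncAF (subsetU1 _ _)) setU11.
Qed.

End Saturation.

(* The default [setT] is irrelevant: by [sat_starP] the minimum is attained as
   soon as P is nonempty. *)
Definition sat_star (n : nat) (d : Order.disp_t) (P : finPOrderType d) : nat :=
  #|[arg min_(F < [set: {set 'I_n}] | induced_saturated P F) #|F|]|.

Lemma sat_starP (n : nat) (d : Order.disp_t) (P : finPOrderType d) :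
  0 < #|P| ->
  (exists2 F : {set {set 'I_n}}, induced_saturated P F & #|F| = sat_star n P)
  /\ (forall F : {set {set 'I_n}}, induced_saturated P F ->
        sat_star n P <= #|F|).
Proof.
move=> /(induced_saturated_exists n)[F0 satF0].
rewrite /sat_star /arg_min /extremum; case: pickP => [F | no_min] /=.
  case/andP=> satF /forallP minF; split; first by exists F.
  by move=> G satG; apply: (implyP (minF G)).
case: (arg_minnP (fun F : {set {set 'I_n}} => #|F|) satF0) => F satF minF.
have /negP[] := negbT (no_min F); rewrite /= satF.
by apply/forallP => G; apply/implyP => /minF.
Qed.

(* Main.v *)
(** Fix [W] of size [s + t - 1]. The singletons [{i}] and co-singletons [~{i}],
    [i] in [W], form a K_{s,t}-free family, since a copy would need [t]
    singletons and [s] co-singletons with distinct indices. Every saturated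
    family [F] extending it is small: if [T] is a [t]-subset of [W], the members
    of [F] containing [T] lie above [t] singletons, so no [s] of them form an
    antichain, and each level of the cube holds at most [s - 1] of them. Dually,
    at most [t - 1] members per level avoid a given [s]-subset of [W]. Each set
    contains a [t]-subset of [W] or avoids an [s]-subset of [W]. *)
Require Import Defs.
From mathcomp Require Import all_boot all_order.

Section Families.
Set Implicit Arguments.
Unset Strict Implicit.
Variable n : nat.
Implicit Types (F G U L X : {set {set 'I_n}}) (A B W T : {set 'I_n}).

(** * Extension to saturated families, copies built from two layers, counting by levels *)

Definition antichain X := {in X &, forall A B, A \subset B -> A = B}.

Lemma saturated_extension (d : Order.disp_t) (P : finPOrderType d) F :
  ~~ contains_induced_copy P F ->
  exists2 G, induced_saturated P G & F \subset G.
Proof.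
move=> freeF.
have [G /maxsetP[freeG maxG] sFG] :=
  @maxset_exists _ (fun G => ~~ contains_induced_copy P G) F freeF.
exists G => //; rewrite /induced_saturated freeG; apply/forallP => A.
apply/implyP => AnG; apply: contraT => freeAG.
by move: AnG; rewrite -(maxG _ freeAG (subsetU1 _ _)) setU11.
Qed.

(** Incomparability inside a layer comes from the antichain hypotheses. Across layers, properness
    rules out the reverse inclusion. *)
Lemma contains_layers s t F U L :
    U \subset F -> L \subset F -> s <= #|U| -> t <= #|L| ->
    antichain U -> antichain L ->
    {in L & U, forall A B, A \proper B} ->
  contains_induced_copy (complete_bipartite s t) F.
Proof.
move=> UF LF sU tL acU acL LU.
(* The default [set0] is never returned: [szU] and [szL] keep all indices in range. *)
pose f (x : complete_bipartite s t) : {set 'I_n} :=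
  match x with
  | inl i => nth set0 (enum U) i
  | inr j => nth set0 (enum L) j
  end.
have szU (i : 'I_s) : i < size (enum U) by rewrite -cardE (leq_trans _ sU).
have szL (j : 'I_t) : j < size (enum L) by rewrite -cardE (leq_trans _ tL).
have fU i : f (inl i) \in U by rewrite -mem_enum mem_nth.
have fL j : f (inr j) \in L by rewrite -mem_enum mem_nth.
have f_le x y : (f x \subset f y) = (x <= y)%O.
  rewrite [RHS]/(cb_le x y).
  case: x y => [i|i] [j|j]; rewrite /cb_le.
  - apply/idP/eqP => [/acU|[->//]].
    move=> /(_ (fU i) (fU j))/eqP.
    by rewrite nth_uniq ?enum_uniq ?szU // => /eqP/val_inj->.
  - apply: negbTE; apply/negP => sub.
    by have := LU _ _ (fL j) (fU i); rewrite properE sub andbF.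
  - by rewrite proper_sub ?LU.
  - apply/idP/eqP => [/acL|[->//]].
    move=> /(_ (fL i) (fL j))/eqP.
    by rewrite nth_uniq ?enum_uniq ?szL // => /eqP/val_inj->.
apply/existsP; exists [ffun x => f x]; apply/and3P; split.
- apply/injectiveP => x y; rewrite !ffunE => fxy.
  by apply: Order.POrderTheory.le_anti; rewrite -!f_le fxy subxx.
- apply/forallP => -[i|j]; rewrite ffunE.
    exact: subsetP UF _ (fU i).
  exact: subsetP LF _ (fL j).
- by apply/forallP => x; apply/forallP => y; rewrite !ffunE f_le.
Qed.

(** Sets of equal size form an antichain, and sizes take only the [n.+1] values from 0 to [n]. *)
Lemma card_bounded_antichains k G :
    (forall X, X \subset G -> antichain X -> #|X| <= k) ->
  #|G| <= k * n.+1.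
Proof.
move=> bG.
have lvl A : #|A| < n.+1 by rewrite ltnS -[X in _ <= X]card_ord max_card.
rewrite -sum1_card (partition_big (fun A => Ordinal (lvl A)) predT) //=.
have -> : k * n.+1 = \sum_(m < n.+1) k by rewrite sum_nat_const card_ord mulnC.
apply: leq_sum => m _; rewrite sum1dep_card.
apply: bG => [|A B].
  by apply/subsetP => A; rewrite inE => /andP[].
rewrite !inE => /andP[_ /eqP Am] /andP[_ /eqP Bm] AB.
apply/eqP; rewrite eqEcard AB /=.
by rewrite -[#|A|]/(val (Ordinal (lvl A))) -[#|B|]/(val (Ordinal (lvl B))) Am Bm.
Qed.

Lemma card_bigcup_le k (I : finType) (S : {set I}) (G : I -> {set {set 'I_n}}) :
  {in S, forall i, #|G i| <= k} -> #|\bigcup_(i in S) G i| <= #|S| * k.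
Proof.
move=> bG; rewrite -sum_nat_const.
elim/big_ind2: _ => [|X a Y b Xa Yb|i /bG//]; first by rewrite cards0.
by rewrite (leq_trans (leq_card_setU _ _)) ?leq_add.
Qed.

(** * Singletons and co-singletons *)

Definition points W : {set {set 'I_n}} := [set [set i] | i in W].
Definition copoints W : {set {set 'I_n}} := [set [set~ i] | i in W].

Lemma antichain_points W : antichain (points W).
Proof.
move=> _ _ /imsetP[i _ ->] /imsetP[j _ ->].
by rewrite sub1set inE => /eqP->.
Qed.

Lemma antichain_copoints W : antichain (copoints W).
Proof.
move=> _ _ /imsetP[i _ ->] /imsetP[j _ ->].
by rewrite setCS sub1set inE => /eqP->.
Qed.

Lemma card_points W : #|points W| = #|W|.
Proof. by rewrite card_imset //; apply: set1_inj. Qed.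

Lemma card_copoints W : #|copoints W| = #|W|.
Proof. by rewrite card_imset // => i j /setC_inj/set1_inj. Qed.

Lemma free_points_copoints s t W :
    1 < s -> 1 < t -> #|W| < s + t ->
  ~~ contains_induced_copy (complete_bipartite s t) (points W :|: copoints W).
Proof.
move=> s_gt1 t_gt1; apply: contraL => /existsP[f /and3P[/injectiveP f_inj]].
move=> /forallP fW /forallP f_le.
have fE x y : (f x \subset f y) = cb_le x y.
  by rewrite (eqP (forallP (f_le x) y)).
pose i0 := Ordinal (ltnW s_gt1).
pose j0 := Ordinal (ltnW t_gt1); pose j1 := Ordinal t_gt1.
(* The subsets of a singleton form a chain, so no singleton contains the two incomparable sets
   [f (inr j0)] and [f (inr j1)]. *)
have up (i : 'I_s) : f (inl i) \in copoints W.
  have := fW (inl i); rewrite inE => /orP[/imsetP[w _ fi]|//].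
  have := fE (inr j1) (inl i); have := fE (inr j0) (inl i).
  have := fE (inr j1) (inr j0); have := fE (inr j0) (inr j1).
  rewrite fi !subset1 /= => f01 f10.
  case/orP=> /eqP f0; case/orP=> /eqP f1;
    by move: f01 f10; rewrite f0 f1 ?subxx ?sub0set.
(* A lower co-singleton would lie inside the upper co-singleton [f (inl i0)], hence equal it,
   against injectivity. *)
have lo (j : 'I_t) : f (inr j) \in points W.
  have := fW (inr j); rewrite inE => /orP[//|fj].
  by have /f_inj : f (inr j) = f (inl i0)
    by apply: antichain_copoints fj (up i0) _; rewrite fE.
have [x|g gW fg] := @fin_all_exists2 (complete_bipartite s t) (fun=> 'I_n)
    (fun _ w => w \in W)
    (fun x w => f x = if x is inl _ then [set~ w] else [set w]).
  by case: x => [i|j]; [case/imsetP: (up i)|case/imsetP: (lo j)] => w; exists w.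
(* Inside a layer the index determines the set. Across layers a shared index [w] would require
   [[set w] \subset [set~ w]]. *)
have g_inj : injective g.
  move=> x y gxy; have := fE x y; have := fE y x; have := f_inj x y.
  rewrite !fg gxy; case: x y {gxy} => [i|j] [i'|j'] fxy; do ?by rewrite fxy.
    by rewrite sub1set !inE eqxx.
  by rewrite sub1set !inE eqxx.
rewrite -leqNgt; have <- : #|{: complete_bipartite s t}| = s + t.
  by rewrite card_sum !card_ord.
rewrite -(card_imset predT g_inj) subset_leq_card //.
by apply/subsetP => _ /imsetP[x _ ->].
Qed.

(** * Members above many singletons or below many co-singletons *)

Lemma card_above_points s t F T :
    0 < s -> 1 < t -> #|T| = t -> points T \subset F ->
    ~~ contains_induced_copy (complete_bipartite s t) F ->
  #|[set A in F | T \subset A]| <= (s - 1) * n.+1.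
Proof.
move=> s_gt0 t_gt1 Tt TF freeF; apply: card_bounded_antichains => X XF acX.
rewrite subn1 -ltnS prednK // ltnNge; apply: contra freeF => sX.
apply: (contains_layers _ TF sX _ acX (@antichain_points T)).
- by apply: subset_trans XF _; apply/subsetP => A; rewrite inE => /andP[].
- by rewrite card_points Tt.
- move=> _ A /imsetP[i iT ->] /(subsetP XF); rewrite inE => /andP[_ TA].
  (* Since [A] has at least [t > 1] elements, the singleton is strictly smaller. *)
  rewrite properEcard sub1set (subsetP TA) //= cards1.
  by rewrite (leq_trans t_gt1) // -Tt subset_leq_card.
Qed.

Lemma card_below_copoints s t F T :
    1 < s -> 0 < t -> #|T| = s -> copoints T \subset F ->
    ~~ contains_induced_copy (complete_bipartite s t) F ->
  #|[set A in F | [disjoint A & T]]| <= (t - 1) * n.+1.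
Proof.
move=> s_gt1 t_gt0 Ts TF freeF; apply: card_bounded_antichains => X XF acX.
rewrite subn1 -ltnS prednK // ltnNge; apply: contra freeF => tX.
apply: (contains_layers TF _ _ tX (@antichain_copoints T) acX).
- by apply: subset_trans XF _; apply/subsetP => A; rewrite inE => /andP[].
- by rewrite card_copoints Ts.
- move=> A B /(subsetP XF); rewrite inE => /andP[_ AT] /imsetP[i iT ->].
  (* By complementation, the claim is that [[set i]] lies strictly inside [~: A], which contains
     [T]. *)
  rewrite -[A]setCK properC properEcard sub1set.
  have TA : T \subset ~: A by rewrite -disjoints_subset disjoint_sym.
  rewrite (subsetP TA) //= cards1.
  by rewrite (leq_trans s_gt1) // -Ts subset_leq_card.
Qed.

(** * Covering the family and summing the bounds *)

Lemma subset_of_card A k : k <= #|A| -> exists2 T : {set 'I_n}, T \subset A & #|T| = k.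
Proof.
rewrite -bin_gt0 -cards_draws => /card_gt0P[T]; rewrite inE.
by move=> /andP[TA /eqP]; exists T.
Qed.

Lemma card_free_family s t W F :
    1 < s -> 1 < t -> #|W| = s + t - 1 ->
    points W :|: copoints W \subset F ->
    ~~ contains_induced_copy (complete_bipartite s t) F ->
  #|F| <= ('C(s + t - 1, t) * (s - 1) + 'C(s + t - 1, t - 1) * (t - 1)) * n.+1.
Proof.
move=> s_gt1 t_gt1 cW; rewrite subUset => /andP[pF qF] freeF.
pose draws k := [set T : {set 'I_n} | T \subset W & #|T| == k].
pose above := \bigcup_(T in draws t) [set A in F | T \subset A].
pose below := \bigcup_(T in draws s) [set A in F | [disjoint A & T]].
have sF : F \subset above :|: below.
  apply/subsetP => A AF; rewrite inE.
  have [tA|At] := leqP t #|W :&: A|.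
    have [T /subsetIP[TW TA] cT] := subset_of_card tA.
    by apply/orP; left; apply/bigcupP; exists T; rewrite inE ?TW ?cT ?AF /=.
  (* Here [A] meets [W] in at most [t - 1] of its [s + t - 1] points. *)
  have sA : s <= #|W :\: A|.
    rewrite -(leq_add2l #|W :&: A|) cardsID cW.
    by rewrite addnC -addnBA ?(ltnW t_gt1) // leq_add2l subn1 -ltnS prednK // ltnW.
  have [T] := subset_of_card sA; rewrite subsetD => /andP[TW TA] cT.
  apply/orP; right; apply/bigcupP; exists T; rewrite inE ?TW ?cT ?AF //=.
  by rewrite disjoint_sym.
apply: leq_trans (subset_leq_card sF) _; apply: leq_trans (leq_card_setU _ _) _.
(* Binomial symmetry turns the second coefficient into the number of [s]-subsets of [W]. *)
have -> : 'C(s + t - 1, t - 1) = 'C(#|W|, s).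
  rewrite cW -bin_sub; last by rewrite -addnBA ?(ltnW t_gt1) // leq_addl.
  by congr 'C(_, _); rewrite -addnBA ?(ltnW t_gt1) // addnK.
rewrite -{1}cW -!cards_draws mulnDl -!mulnA leq_add // card_bigcup_le // => T.
  rewrite inE => /andP[TW /eqP cT].
  apply: card_above_points (ltnW s_gt1) t_gt1 cT _ freeF.
  exact: subset_trans (imsetS _ TW) pF.
rewrite inE => /andP[TW /eqP cT].
apply: card_below_copoints s_gt1 (ltnW t_gt1) cT _ freeF.
exact: subset_trans (imsetS _ TW) qF.
Qed.

End Families.

Theorem theorem1 (s t : nat) (ht : 2 <= t) (hst : t <= s) :
  exists c : nat, forall n : nat, 2 * s + t - 1 <= n ->
    sat_star n (complete_bipartite s t) <=
      ('C(s + t - 1, t) * (s - 1) + 'C(s + t - 1, t - 1) * (t - 1)) * n + c.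
Proof.
(* The bound is linear in [n.+1], so the constant is one extra copy of the slope. *)
exists ('C(s + t - 1, t) * (s - 1) + 'C(s + t - 1, t - 1) * (t - 1)) => n n_ge.
have hs : 1 < s := leq_trans ht hst.
have [W _ cW] : exists2 W : {set 'I_n}, W \subset setT & #|W| = s + t - 1.
  apply: subset_of_card; rewrite cardsT card_ord (leq_trans _ n_ge) //.
  by rewrite leq_sub2r // leq_add2r leq_pmull.
have Wst : #|W| < s + t by rewrite cW subn1 prednK // addn_gt0 (ltnW hs).
have [F satF WF] := saturated_extension (free_points_copoints hs ht Wst).
have [freeF _] := andP satF.
have cP : 0 < #|{: complete_bipartite s t}|.
  by apply/card_gt0P; exists (inr (Ordinal (ltnW ht))).
rewrite -mulnSr (leq_trans ((sat_starP n cP).2 F satF)) //.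
exact: card_free_family hs ht cW WF freeF.
Qed.
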